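(* Let $\overline{A_0A_1A_2A_3}$ be a tetrahedron in $\mathbb{A}^3$ that is $B$-tri-rectangular at $A_0$. Then its $B$-quadreas satisfy $$\mathcal{A}_{123}=\mathcal{A}_{012}+\mathcal{A}_{013}+\mathcal{A}_{023}.$$
   Context: Let $\mathbb{F}$ be a field of characteristic not $2$, $\mathbb{V}^3=\mathbb{F}^3$ the space of row vectors, and $\mathbb{A}^3$ the three-dimensional affine space over $\mathbb{F}$ with associated vector space $\mathbb{V}^3$; $\overrightarrow{XY}=Y-X$ for points $X,Y$. Let $B$ be a symmetric invertible $3\times3$ matrix over $\mathbb{F}$. Define $v\cdot_B w=vBw^T$ and $Q_B(v)=v\cdot_B v$. A tetrahedron $\overline{A_0A_1A_2A_3}$ is a collection of four points of $\mathbb{A}^3$. Put $Q_{ij}=Q_B(\overrightarrow{A_iA_j})$ (symmetric in $i,j$). The $B$-quadrea of the triangle $\overline{A_iA_jA_k}$ is $\mathcal{A}_{ijk}=A(Q_{ij},Q_{ik},Q_{jk})$ with $A(a,b,c)=(a+b+c)^2-2(a^2+b^2+c^2)$. The tetrahedron is $B$-tri-rectangular at $A_0$ if the vectors $v_i=\overrightarrow{A_0A_i}$ ($i=1,2,3$) are mutually $B$-perpendicular: $v_1\cdot_B v_2=v_1\cdot_B v_3=v_2\cdot_B v_3=0$. *)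

(* Defs.v *)
From mathcomp Require Import all_boot all_algebra.

Set Implicit Arguments.
Unset Strict Implicit.
Unset Printing Implicit Defensive.

Import GRing.Theory.
Local Open Scope ring_scope.

(* The affine space A^3 is given in coordinates: its points are row triples,
   kept under a separate name from the vectors of V^3. *)
Definition point (F : fieldType) : Type := 'rV[F]_3.

Definition vec (F : fieldType) (X Y : point F) : 'rV[F]_3 :=
  (Y : 'rV[F]_3) - (X : 'rV[F]_3).

(* [v *m B *m w^T] is a 1 x 1 matrix; the scalar is its only entry. *)
Definition bdot (F : fieldType) (B : 'M[F]_3) (v w : 'rV[F]_3) : F :=
  (v *m B *m w^T) 0 0.

Definition bperp (F : fieldType) (B : 'M[F]_3) (v w : 'rV[F]_3) : Prop :=
  bdot B v w = 0.

Definition vquadrance (F : fieldType) (B : 'M[F]_3) (v : 'rV[F]_3) : F :=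
  bdot B v v.

Definition quadrance (F : fieldType) (B : 'M[F]_3) (X Y : point F) : F :=
  vquadrance B (vec X Y).

Definition archimedes (F : fieldType) (a b c : F) : F :=
  (a + b + c) ^+ 2 - 2 * (a ^+ 2 + b ^+ 2 + c ^+ 2).

Definition quadrea (F : fieldType) (B : 'M[F]_3) (X Y Z : point F) : F :=
  archimedes (quadrance B X Y) (quadrance B X Z) (quadrance B Y Z).

(* A tetrahedron is any four points: no non-degeneracy is required. *)
Definition tri_rectangular (F : fieldType) (B : 'M[F]_3)
    (A0 A1 A2 A3 : point F) : Prop :=
  [/\ bperp B (vec A0 A1) (vec A0 A2),
      bperp B (vec A0 A1) (vec A0 A3) &
      bperp B (vec A0 A2) (vec A0 A3)].

(* Main.v *)
Require Import Defs.
From mathcomp Require Import all_boot all_algebra.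
From mathcomp Require Import ring.

Import GRing.Theory.
Local Open Scope ring_scope.

(** Write [q1], [q2], [q3] for the quadrances of the three edges at [A0].
    By Pythagoras ([pythagoras]), applied to the three right angles at [A0],
    the opposite edges have quadrances [q1 + q2], [q1 + q3] and [q2 + q3].
    So all six quadrances are expressed by [q1], [q2], [q3], and the claim
    becomes a polynomial identity: a face with its right angle at [A0] has
    quadrea [4 qi qj], as [archimedes a b (a + b) = 4 a b], while
    [archimedes (a + b) (a + c) (b + c) = 4 (a b + a c + b c)]. *)

Lemma bdot_sym (F : fieldType) (B : 'M[F]_3) (v w : 'rV[F]_3) :
  B^T = B -> bdot B v w = bdot B w v.
Proof.
(* A 1 x 1 matrix is its own transpose. *)
move=> Bsym; rewrite /bdot -[in LHS](trmxK (v *m B *m w^T)) mxE.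
by rewrite !trmx_mul trmxK Bsym mulmxA.
Qed.

Lemma vquadranceB (F : fieldType) (B : 'M[F]_3) (v w : 'rV[F]_3) :
  vquadrance B (w - v) =
    vquadrance B v + vquadrance B w - bdot B v w - bdot B w v.
Proof.
rewrite /vquadrance /bdot linearB /= !mulmxBl !mulmxBr !mxE.
by ring.
Qed.

(** The edge [XY] is the difference of the edges [OY] and [OX], and symmetry
    of [B] makes both cross terms of its quadrance vanish. *)
Lemma pythagoras (F : fieldType) (B : 'M[F]_3) (O X Y : point F) :
  B^T = B -> bperp B (vec O X) (vec O Y) ->
  quadrance B X Y = quadrance B O X + quadrance B O Y.
Proof.
move=> Bsym XperpY; rewrite /quadrance.
have -> : vec X Y = vec O Y - vec O X by rewrite /vec opprB addrA subrK.
by rewrite vquadranceB (bdot_sym _ _ (vec O Y)) // XperpY !subr0.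
Qed.

Theorem theorem25 (F : fieldType) (hF : 2%N \notin [pchar F])
    (B : 'M[F]_3) (hBsym : B^T = B) (hBinv : B \in unitmx)
    (A0 A1 A2 A3 : point F) (htri : tri_rectangular B A0 A1 A2 A3) :
  quadrea B A1 A2 A3 =
    quadrea B A0 A1 A2 + quadrea B A0 A1 A3 + quadrea B A0 A2 A3.
Proof.
case: htri => perp12 perp13 perp23; rewrite /quadrea.
rewrite (pythagoras _ _ _ _ _ hBsym perp12) (pythagoras _ _ _ _ _ hBsym perp13).
rewrite (pythagoras _ _ _ _ _ hBsym perp23) /archimedes.
by ring.
Qed.
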